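(* Let $K$ be a field of characteristic $0$, and let $a(z)=\sum_{i=0}^u a_iz^i$, $b(z)=\sum_{j=0}^v b_jz^j\in K[z]$ with $a_u\ne0$, $b_v\neq 0$. Put $w=\max\{u-2,v-1\}$ and assume $w\ge 0$, and that if $u-1=v$ then $a_u(k+u)+b_v\neq0$ for all integers $k\ge0$. Let $L=-a(z)\frac{d}{dz}+b(z)$ and let $f_0(z),\ldots,f_w(z)\in(1/z)K[[1/z]]$ be linearly independent over $K$ with $L\cdot f_j(z)\in K[z]$ for $0\le j\le w$. Assume moreover that (a) for every positive integer $n$, the polynomials $na'(z)+b(z)$ and $a(z)$ are coprime, and (b) if $u-1=v$, then $a_u((k+1)u+n)+b_v\ne0$ for all integers $k,n\ge0$. Then for every integer $n\ge0$, $\Delta_n(z)\in K\setminus\{0\}$.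
   Context: For $f=\sum_{k\ge0}f_k z^{-k-1}\in(1/z)K[[1/z]]$, $L\cdot f=-a(z)f'(z)+b(z)f(z)$ with termwise differentiation. The formal $f$-integration map $\varphi_f:K[t]\to K$ is the $K$-linear map with $\varphi_f(t^k)=f_k$ ($k\ge0$), extended $K[z]$-linearly to $K[z,t]\to K[z]$. Write $\varphi_j=\varphi_{f_j}$. For integers $n,\ell\ge0$ let $P_{n,\ell}(z)=\frac{1}{n!}\bigl(\frac{d}{dz}+\frac{b(z)}{a(z)}\bigr)^n\bigl(a(z)^n z^\ell\bigr)$ (the operator $\frac{d}{dz}+\frac{b}{a}$ applied $n$ times to $a^nz^\ell$; this is a polynomial), and $Q_{n,j,\ell}(z)=\varphi_j\bigl(\frac{P_{n,\ell}(z)-P_{n,\ell}(t)}{z-t}\bigr)\in K[z]$ for $0\le j\le w$. Then $\Delta_n(z)$ is the determinant of the $(w+2)\times(w+2)$ matrix whose first row is $(P_{n,0}(z),\ldots,P_{n,w+1}(z))$ and whose $(j+2)$-th row is $(Q_{n,j,0}(z),\ldots,Q_{n,j,w+1}(z))$ for $0\le j\le w$. *)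

(* Defs.v *)
From HB Require Import structures.
From mathcomp Require Import all_boot all_order all_algebra.
Set Implicit Arguments. Unset Strict Implicit. Unset Printing Implicit Defensive.
Import Order.TTheory GRing.Theory Num.Theory.
Local Open Scope ring_scope.

Section Defs.
Variable K : fieldType.

(* A formal series f = \sum_{k>=0} f_k z^{-k-1} in (1/z)K[[1/z]] is
   represented by its coefficient sequence f : nat -> K. *)

(* termwise derivative: (z^{-k-1})' = -(k+1) z^{-k-2};
   result again in (1/z)K[[1/z]] (its z^{-1} coefficient is 0). *)
Definition sderiv (f : nat -> K) : nat -> K :=
  fun k => if k is k'.+1 then - (k'.+1)%:R * f k' else 0.

(* coefficient of z^{-(j+1)} in the Laurent series p(z) * g(z) *)
Definition negcoef (p : {poly K}) (g : nat -> K) (j : nat) : K :=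
  \sum_(i < size p) p`_i * g (i + j)%N.

(* L . f = -a f' + b f lies in K[z]: all coefficients of negative powers of z vanish *)
Definition L_in_poly (a b : {poly K}) (f : nat -> K) : Prop :=
  forall j : nat, - negcoef a (sderiv f) j + negcoef b f j = 0.

(* w = max(u-2, v-1), with u = deg a, v = deg b (assumed >= 0 separately) *)
Definition wdeg (a b : {poly K}) : nat :=
  maxn ((size a).-1 - 2) ((size b).-1 - 1).

(* The operator d/dz + b/a acting on a rational function represented as a pair
   (numerator, denominator):  (p/q)' + (b/a)(p/q) = (a(p'q - pq') + bpq)/(a q^2). *)
Definition opDba (a b : {poly K}) (x : {poly K} * {poly K}) : {poly K} * {poly K} :=
  let: (p, q) := x in
  (a * (p^`() * q - p * q^`()) + b * p * q, a * q ^+ 2).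

(* P_{n,l}(z) = 1/n! (d/dz + b/a)^n (a^n z^l)  (a polynomial) *)
Definition Ppol (a b : {poly K}) (n l : nat) : {poly K} :=
  let: (N, D) := iter n (opDba a b) (a ^+ n * 'X^l, 1) in
  (n`!%:R)^-1 *: (N %/ D).

Definition phi (f : nat -> K) (p : {poly K}) : K :=
  \sum_(k < size p) p`_k * f k.

(* (P(z) - P(t))/(z - t) as a polynomial in t (outer) with coefficients in K[z]:
   \sum_k P_k \sum_{i+m=k-1} z^i t^m *)
Definition divdiff (P : {poly K}) : {poly {poly K}} :=
  \sum_(k < size P) (P`_k)%:P%:P *
     \sum_(i < k) ('X^i)%:P * 'X^(k.-1 - i).

Definition phiz (f : nat -> K) (Q : {poly {poly K}}) : {poly K} :=
  \sum_(m < size Q) Q`_m * (f m)%:P.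

Definition Qpol (a b : {poly K}) (f : nat -> K) (n l : nat) : {poly K} :=
  phiz f (divdiff (Ppol a b n l)).

Definition Delta (a b : {poly K}) (fs : 'I_(wdeg a b).+1 -> nat -> K) (n : nat)
  : {poly K} :=
  \det (\matrix_(i < (wdeg a b).+2, j < (wdeg a b).+2)
          if unlift ord0 i is Some i' then Qpol a b (fs i') n j
          else Ppol a b n j).

Definition series_free (w : nat) (fs : 'I_w -> nat -> K) : Prop :=
  forall c : 'I_w -> K,
    (forall k : nat, \sum_(j < w) c j * fs j k = 0) -> forall j, c j = 0.

End Defs.

(* Main.v *)
(** Put [D_k p = a p' + (k a' + b) p], so that [(d/dz + b/a) (a^k p) = a^(k-1) D_k p]
    and [P_{n,l} = D_1 ... D_n z^l / n!]. The condition [L f in K[z]] says exactly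
    that [phi_f] kills the image of [D_1]; integrating by parts,
    [phi_f (t^k P_{n,l})] is [0] for [k < n] and [(-1)^n phi_f (a^n t^l)] for [k = n].
    Hence [R_{j,l} = P_{n,l} f_j - Q_{n,j,l}] has order at least [n + 1] at infinity.
    Replacing the [Q] rows of the determinant by the [R] rows, and since
    [deg P_{n,l} = l + n (w + 1)], the polynomial [Delta_n] has degree at most [0],
    and its value is, up to sign, the leading coefficient of [P_{n,w+1}] times
    [det (phi_j (a^n t^l))_{j,l <= w}]. If the latter vanished, some [p <> 0] of
    degree at most [w] would satisfy [a^n p = D_1 q], as the [phi_j] form a basis
    of the dual of the cokernel of [D_1]. By coprimality [a] divides [q], and
    [D_k (a q) = a D_{k+1} q], so the powers of [a] cancel one by one and leave
    [p = D_{n+1} q'], which is impossible since [D_{n+1}] raises degrees by [w + 1]. *)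
Require Import Defs.
From HB Require Import structures.
From mathcomp Require Import all_boot all_order all_algebra.
From mathcomp Require Import perm ring zify.
Import Order.TTheory GRing.Theory Num.Theory.
Local Open Scope ring_scope.

(** * Top coefficients of products and determinants *)

Section TopCoefficients.
Variable K : fieldType.
Implicit Types (p q : {poly K}).

Lemma coefM_top p q m n :
  (size p <= m.+1)%N -> (size q <= n.+1)%N -> (p * q)`_(m + n) = p`_m * q`_n.
Proof.
move=> sp sq; rewrite coefM.
have hm : (m < (m + n).+1)%N by lia.
rewrite (bigD1 (Ordinal hm)) //= addKn big1 ?addr0 // => i ne_im.
have {}ne_im : nat_of_ord i != m by apply: contra ne_im => /eqP e; apply/eqP/val_inj.
have [lt_im|le_mi] := ltnP i m.
  by rewrite (nth_default 0 (leq_trans sq _)) ?mulr0 //; lia.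
by rewrite (nth_default 0 (leq_trans sp _)) ?mul0r //; lia.
Qed.

Lemma size_mul_top p q m n :
  (size p <= m.+1)%N -> (size q <= n.+1)%N -> (size (p * q)%R <= (m + n).+1)%N.
Proof.
by move=> sp sq; apply: leq_trans (size_polyMleq _ _) _; lia.
Qed.

(** Every Leibniz product takes one entry from each row, so the row bounds add up and the
    coefficients at the bounds multiply. *)
Lemma size_det_top m (M : 'M[{poly K}]_m) (r : 'I_m -> nat) :
  (forall i j, (size (M i j) <= (r i).+1)%N) ->
  (size (\det M) <= (\sum_i r i).+1)%N
  /\ (\det M)`_(\sum_i r i) = \det (\matrix_(i, j) (M i j)`_(r i)).
Proof.
move=> sM.
have prod_top (s : 'I_m -> 'I_m) :
    (size (\prod_i M i (s i))%R <= (\sum_i r i).+1)%N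
    /\ (\prod_i M i (s i))`_(\sum_i r i) = \prod_i (M i (s i))`_(r i).
  elim/big_rec3: _ => [|i y1 x y2 _ [IHs IHc]].
    by rewrite size_poly1 coef1.
  by rewrite size_mul_top // coefM_top // IHc.
split.
  apply: leq_trans (size_sum _ _ _) _; apply/bigmax_leqP => s _.
  by rewrite size_Msign; have [] := prod_top s.
rewrite coef_sum; apply: eq_bigr => s _.
have [_ c] := prod_top s; under [in RHS]eq_bigr do rewrite mxE.
by rewrite -c; case: (odd_perm s); rewrite ?mulN1r ?mul1r ?coefN.
Qed.

End TopCoefficients.

(** * Formal integration, divided differences and remainders *)

Section FormalIntegration.
Variable K : fieldType.
Implicit Types (f : nat -> K) (p : {poly K}).

Lemma phi_widen f p n :
  (size p <= n)%N -> phi f p = \sum_(k < n) p`_k * f k.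
Proof.
move=> sp; rewrite /phi (big_ord_widen n (fun k => p`_k * f k)) //.
rewrite big_mkcond; apply: eq_bigr => i _; case: ltnP => // ?.
by rewrite nth_default // mul0r.
Qed.

Lemma phi_is_scalar f : scalar (phi f).
Proof.
move=> c p q; set n := maxn (size p) (size q).
have sp : (size p <= n)%N by rewrite leq_maxl.
have sq : (size q <= n)%N by rewrite leq_maxr.
rewrite !(@phi_widen f _ n) //; last first.
  apply: leq_trans (size_polyD _ _) _; rewrite geq_max sq andbT.
  exact: leq_trans (size_scale_leq _ _) sp.
rewrite mulr_sumr -big_split; apply: eq_bigr => i _ /=.
by rewrite coefD coefZ mulrDl mulrA.
Qed.

HB.instance Definition _ f :=
  GRing.isLinear.Build K {poly K} K *%R (phi f) (phi_is_scalar f).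

Lemma phiXn f k : phi f 'X^k = f k.
Proof.
rewrite /phi size_polyXn big_ord_recr /= coefXn eqxx mul1r big1 ?add0r // => i _.
by rewrite coefXn ltn_eqF // mul0r.
Qed.

Lemma phi_XnM f k p n :
  (size p <= n)%N -> phi f ('X^k * p) = \sum_(d < n) p`_d * f (k + d)%N.
Proof.
move=> sp; rewrite -[in LHS](coefK p) poly_def.
rewrite (big_ord_widen n (fun i => p`_i *: 'X^i)) // mulr_sumr linear_sum /=.
rewrite big_mkcond; apply: eq_bigr => i _; case: ltnP => [_|?].
  by rewrite -scalerAr linearZ /= -exprD phiXn.
by rewrite nth_default // mul0r.
Qed.

Lemma coef_divdiff p m e : (divdiff p)`_m`_e = p`_(m + e).+1.
Proof.
rewrite /divdiff coef_sum coef_sum.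
have inner (k : nat) :
    ((p`_k)%:P%:P * \sum_(i < k) ('X^i)%:P * 'X^(k.-1 - i))`_m`_e
    = if k == (m + e).+1 then p`_k else 0.
  rewrite coefCM coefCM coef_sum coef_sum.
  have term (i : 'I_k) :
      ((('X^i)%:P * 'X^(k.-1 - i) : {poly {poly K}})`_m)`_e
      = ((i == e :> nat) && (k == (m + e).+1))%:R.
    rewrite coefCM coefXn; have lt_ik := ltn_ord i.
    have [ie|ne_ie] := eqVneq (i : nat) e; last first.
      by case: eqP => _; rewrite ?mulr1 ?mulr0 ?coef0 ?coefXn // eq_sym (negbTE ne_ie).
    rewrite ie in lt_ik *.
    have -> : (m == k.-1 - e)%N = (k == (m + e).+1) by move: lt_ik; lia.
    by case: eqP => _; rewrite ?mulr1 ?mulr0 ?coef0 ?coefXn ?eqxx.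
  rewrite (eq_bigr _ (fun i _ => term i)).
  case: eqP => [k_eq|_]; last first.
    by rewrite big1 ?mulr0 // => i _; rewrite andbF.
  have lt_ek : (e < k)%N by rewrite k_eq; lia.
  rewrite (bigD1 (Ordinal lt_ek)) //= eqxx big1 ?addr0 ?mulr1 // => i ne_ie.
  by rewrite andbT; case: eqP => // ie; case/eqP: ne_ie; apply: val_inj.
rewrite (eq_bigr _ (fun (i : 'I_(size p)) _ => inner i)) -big_mkcond /=.
have [lt|ge] := ltnP (m + e).+1 (size p).
  by rewrite (big_pred1 (Ordinal lt)).
rewrite nth_default // big_pred0 // => i; apply/eqP => ie.
by have := ltn_ord i; rewrite ie ltnNge ge.
Qed.

Lemma coef_phiz_divdiff f p n e :
  (size p <= n)%N ->
  (phiz f (divdiff p))`_e = \sum_(m < n) p`_(m + e).+1 * f m.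
Proof.
move=> sp.
have sd : (size (divdiff p) <= n)%N.
  apply/leq_sizeP => j le_nj; apply/polyP => i.
  by rewrite coef_divdiff coef0 nth_default //; apply: leq_trans sp _; lia.
rewrite /phiz coef_sum.
rewrite (big_ord_widen n (fun m => ((divdiff p)`_m * (f m)%:P)`_e)) // big_mkcond.
apply: eq_bigr => m _; case: ltnP => [_|sm].
  by rewrite coefMC coef_divdiff.
by rewrite -coef_divdiff (nth_default 0 sm) coef0 mul0r.
Qed.

(* Stands for [z^N (p f - Q)], where [Q] is the polynomial part of [p f]:
   replacing [z^N f] by its polynomial part keeps the computation in [K[z]] and
   leaves the [n + 1] coefficients below [z^N] intact once [N > size p + n]. *)
Definition remainder f N p : {poly K} :=
  (\poly_(i < N) f (N.-1 - i)%N) * p - 'X^N * phiz f (divdiff p).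

(** From [N] on, the truncated product carries exactly the polynomial part of [p f], which the
    divided difference removes; [size p <= N] keeps the truncation of [f] from mattering. *)
Lemma coef_remainder_high f N p i :
  (size p <= N)%N -> (N <= i)%N -> (remainder f N p)`_i = 0.
Proof.
move=> sp le_Ni; rewrite /remainder coefB coefXnM ltnNge le_Ni /=.
rewrite (coef_phiz_divdiff f p N) // coefMr.
apply/eqP; rewrite subr_eq0; apply/eqP.
rewrite -(big_mkord xpredT (fun m => p`_(m + (i - N)).+1 * f m)).
rewrite -(big_mkord xpredT (fun j => (\poly_(i0 < N) f (N.-1 - i0)%N)`_(i - j) * p`_j)).
rewrite (big_cat_nat (n := (i - N).+1)) //=; last by lia.
rewrite big_nat big1 ?add0r; last first.
  by move=> j hj; rewrite coef_poly ifN ?mul0r //; lia.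
rewrite -{1}[(i - N).+1]add0n big_addn.
have -> : (i.+1 - (i - N).+1 = N)%N by lia.
rewrite !big_nat; apply: eq_bigr => j hj.
rewrite coef_poly ifT; last by lia.
rewrite mulrC; congr (p`_ _ * f _); lia.
Qed.

(** Index [N.-1 - k] stands for [z^(-k-1)], whose coefficient in [p f] is the integral of
    [t^k p]. *)
Lemma coef_remainder f N p k :
  (k + size p <= N)%N -> (k < N)%N ->
  (remainder f N p)`_(N.-1 - k) = phi f ('X^k * p).
Proof.
move=> sp lt_kN; rewrite /remainder coefB coefXnM ifT; last by lia.
rewrite subr0 coefMr (phi_XnM f k p (N.-1 - k).+1); last by lia.
apply: eq_bigr => j _; have lt_j := ltn_ord j.
rewrite coef_poly ifT; last by lia.
rewrite mulrC; congr (_ * f _); lia.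
Qed.

End FormalIntegration.

(** * The operators [D_k] and integration by parts *)

Section Operator.
Variables (K : fieldType) (a b : {poly K}).
Implicit Types (f : nat -> K) (p q r : {poly K}).

(* [(d/dz + b/a) (a^k p) = a^(k-1) Dop k p] *)
Definition Dop (k : nat) p : {poly K} := a * p^`() + (k%:R *: a^`() + b) * p.

Fixpoint Dchain (n : nat) p : {poly K} :=
  if n is n'.+1 then Dchain n' (Dop n p) else p.

Lemma DopMa k p : Dop k (a * p) = a * Dop k.+1 p.
Proof. by rewrite /Dop derivM -!mul_polyC -natr1 polyCD; ring. Qed.

Lemma DopMXn k n p :
  'X^n * Dop k p = Dop k ('X^n * p) - n%:R *: ('X^(n.-1) * (a * p)).
Proof.
by rewrite /Dop derivM derivXn -!mul_polyC polyC_natr -mulr_natl; ring.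
Qed.

Lemma DopD k p q : Dop k (p + q) = Dop k p + Dop k q.
Proof. by rewrite /Dop derivD; ring. Qed.

(** Fractions are never reduced: one step turns [d a^(n+1) r / d] into [d' a^n D_(n+1) r / d'] with
    [d' = a d^2], hence the general [d]. *)
Lemma iter_opDba n d r : a != 0 -> d != 0 ->
  let: (N, D) := iter n (opDba a b) (d * a ^+ n * r, d) in N %/ D = Dchain n r.
Proof.
move=> a0; elim: n d r => [|n IH] d r d0.
  by rewrite /= expr0 mulr1 mulKp.
rewrite iterSr /=.
have -> : a * ((d * a ^+ n.+1 * r)^`() * d - d * a ^+ n.+1 * r * d^`())
            + b * (d * a ^+ n.+1 * r) * d = a * d ^+ 2 * a ^+ n * Dop n.+1 r.
  by rewrite /Dop !derivM deriv_exp /= -mulr_natl exprS -mul_polyC polyC_natr; ring.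
by apply: IH; rewrite mulf_neq0 // expf_neq0.
Qed.

Lemma PpolE n l : a != 0 -> Ppol a b n l = (n`!%:R)^-1 *: Dchain n 'X^l.
Proof.
move=> a0; have := iter_opDba n 1 'X^l a0 (oner_neq0 _).
by rewrite mul1r /Ppol; case: (iter _ _ _) => N D ->.
Qed.

(** The rule [a D_(k+1) = D_k a] carries a factor [a] inward through the chain, lowering each index;
    this isolates the outermost [D_1]. *)
Lemma Dchain_Dop1 n r :
  exists2 s, Dchain n.+1 r = Dop 1 s & a * s = Dchain n (a * r).
Proof.
elim: n r => [|n IH] r; first by exists r.
by have [s e1 e2] := IH (Dop n.+2 r); exists s; rewrite // e2 -DopMa.
Qed.

Lemma negcoef_widen f p j n : (size p <= n)%N ->
  negcoef p f j = \sum_(i < n) p`_i * f (i + j)%N.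
Proof.
move=> sp; rewrite /negcoef.
rewrite (big_ord_widen n (fun i => p`_i * f (i + j)%N)) // big_mkcond.
by apply: eq_bigr => i _; case: ltnP => // ?; rewrite nth_default // mul0r.
Qed.

(** On a monomial, [D_1 z^i = (a z^i)' + b z^i]. Termwise differentiation of [f] is minus the
    transpose of [d/dt], so the value is the coefficient of [z^(-i-1)] in [L f]. *)
Lemma phi_Dop1 f p : L_in_poly a b f -> phi f (Dop 1 p) = 0.
Proof.
move=> Lf; rewrite -[p]coefK poly_def.
elim/big_rec: _ => [|i x _ IH].
  by rewrite /Dop deriv0 !mulr0 addr0 linear0.
rewrite DopD linearD /= IH addr0.
have -> : Dop 1 (p`_i *: 'X^i) = p`_i *: Dop 1 'X^i.
  by rewrite /Dop derivZ -!mul_polyC; ring.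
rewrite linearZ /=.
have -> : Dop 1 'X^i = (a * 'X^i)^`() + 'X^i * b.
  by rewrite /Dop derivM scale1r; ring.
rewrite linearD /= (phi_XnM _ _ _ _ _ (leqnn _)).
have -> : phi f (a * 'X^i)^`() = - negcoef a (sderiv f) i.
  rewrite (phi_widen _ _ _ (size a + i)); last first.
    apply: leq_trans (size_poly _ _) _.
    apply: leq_trans (leq_pred _) _.
    by apply: leq_trans (size_polyMleq _ _) _; rewrite size_polyXn addnS.
  (* The added term [k = 0] carries the factor [0], so the value [0.-1 = 0] is harmless and
     [sderiv f 0 = 0] is matched. *)
  transitivity (\sum_(k < (size a + i).+1) (a * 'X^i)`_k * k%:R * f k.-1).
    rewrite big_ord_recl /= mulr0 mul0r add0r; apply: eq_bigr => k _.
    by rewrite coef_deriv /bump /= add1n mulr_natr.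
  rewrite -addSn addnC big_split_ord /= big1 ?add0r; last first.
    by move=> k _; rewrite coefMXn ltn_ord !mul0r.
  rewrite (negcoef_widen _ _ _ (size a).+1) // -sumrN; apply: eq_bigr => k _.
  rewrite coefMXn ltnNge leq_addr /= addKn addnC.
  by rewrite /sderiv; case: (_ + _)%N => [|m] /=; ring.
have -> : \sum_(d < size b) b`_d * f (i + d)%N = negcoef b f i.
  by apply: eq_bigr => d _; rewrite addnC.
by rewrite Lf mulr0.
Qed.

(** Integration by parts: [t^k D_1 s = D_1 (t^k s) - k t^(k-1) a s], and [phi f] kills the first
    term. *)
Lemma phi_XnM_Dchain f n r k : L_in_poly a b f ->
  phi f ('X^k * Dchain n.+1 r) = - (k%:R * phi f ('X^(k.-1) * Dchain n (a * r))).
Proof.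
move=> Lf; have [s -> <-] := Dchain_Dop1 n r.
by rewrite DopMXn linearB /= (phi_Dop1 _ _ Lf) sub0r linearZ.
Qed.

Lemma phi_Dchain_orth f n r k : L_in_poly a b f -> (k < n)%N ->
  phi f ('X^k * Dchain n r) = 0.
Proof.
move=> Lf; elim: n r k => // n IH r [|k] lt_kn; rewrite phi_XnM_Dchain //.
  by rewrite mul0r oppr0.
by rewrite IH // mulr0 oppr0.
Qed.

Lemma phi_Dchain_top f n r : L_in_poly a b f ->
  phi f ('X^n * Dchain n r) = (-1) ^+ n * n`!%:R * phi f (a ^+ n * r).
Proof.
move=> Lf; elim: n r => [|n IH] r; first by rewrite !expr0 !mul1r.
rewrite phi_XnM_Dchain //= IH factS natrM !exprS mulrA.
by rewrite [a ^+ n * a]mulrC; ring.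
Qed.

(** * Degree growth under [D_k] and division by its image *)

Section Degree.
Variable w : nat.
Hypotheses (sa : (size a <= w.+3)%N) (sb : (size b <= w.+2)%N).

(* The factor by which [Dop k] multiplies the leading coefficient in degree [e]. *)
Definition indicial (k e : nat) : K := a`_w.+2 * (k * w.+2 + e)%:R + b`_w.+1.

Lemma Dop_top k p e : (size p <= e.+1)%N ->
  (size (Dop k p) <= (e + w.+1).+1)%N
  /\ (Dop k p)`_(e + w.+1) = indicial k e * p`_e.
Proof.
move=> sp.
have sc : (size (k%:R *: a^`() + b)%R <= w.+2)%N.
  apply: leq_trans (size_polyD _ _) _; rewrite geq_max sb andbT.
  apply: leq_trans (size_scale_leq _ _) _.
  apply: leq_trans (size_poly _ _) _; lia.
have cc : (k%:R *: a^`() + b)`_w.+1 = k%:R * (a`_w.+2 * (w.+2)%:R) + b`_w.+1.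
  by rewrite coefD coefZ coef_deriv mulr_natr.
rewrite /indicial /Dop; case: e sp => [|e] sp.
  have -> : p^`() = 0 by rewrite (size1_polyC sp) derivC.
  have := size_mul_top _ _ _ _ _ sc sp; have := coefM_top _ _ _ _ _ sc sp.
  rewrite mulr0 add0r add0n !addn0 => -> s1; split=> //.
  by rewrite cc natrM; ring.
have sd : (size p^`() <= e.+1)%N by apply: leq_trans (size_poly _ _) _; lia.
rewrite addSnnS addnC; split.
  apply: leq_trans (size_polyD _ _) _; rewrite geq_max size_mul_top //=.
  by rewrite addSnnS size_mul_top.
rewrite coefD coefM_top // addSnnS coefM_top // cc coef_deriv natrD natrM.
rewrite -mulr_natr; ring.
Qed.

Lemma Dchain_top n p e : (size p <= e.+1)%N ->
  (size (Dchain n p) <= (e + n * w.+1).+1)%N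
  /\ (Dchain n p)`_(e + n * w.+1)
     = (\prod_(i < n) indicial i.+1 (e + (n - i.+1) * w.+1)) * p`_e.
Proof.
elim: n p e => [|n IH] p e sp; first by rewrite big_ord0 mul1r addn0.
have [s1 c1] := Dop_top n.+1 p e sp; have [s2 c2] := IH _ _ s1.
rewrite /= mulSn addnA; split=> //; rewrite c2 c1 big_ord_recr /= subnn addn0.
rewrite mulrA; congr (_ * _ * _); apply: eq_bigr => i _; congr indicial.
by rewrite -addnA -mulSn -subSn.
Qed.

Hypothesis indicial_neq0 : forall k e, indicial k.+1 e != 0.

Lemma Dop_small_eq0 k p : (size (Dop k.+1 p) <= w.+1)%N -> p = 0.
Proof.
move=> sD; apply/eqP; rewrite -lead_coef_eq0; apply/negPn/negP => p0.
have sp : (size p <= (size p).-1.+1)%N by exact: leqSpred.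
have [_ c] := Dop_top k.+1 p _ sp; move: c.
rewrite nth_default; last exact: leq_trans sD (leq_addl _ _).
by move/esym/eqP; rewrite mulf_eq0 (negbTE (indicial_neq0 _ _)) (negbTE p0).
Qed.

(** As in Euclidean division, a top term of degree at least [w + 1] is cancelled by [D_1] of a
    suitable monomial. *)
Lemma Dop1_division p :
  exists q, exists2 r, p = Dop 1 q + r & (size r <= w.+1)%N.
Proof.
have [n sn] := ubnP (size p).
elim: n p sn => // n IH p; rewrite ltnS => sp.
have [le_nw|lt_wn] := leqP n w.+1.
  exists 0, p; last exact: leq_trans sp le_nw.
  by rewrite /Dop deriv0 !mulr0 !add0r.
pose e := (n - w.+2)%N; have en : n = (e + w.+1).+1 by rewrite /e; lia.
pose q0 := (p`_(e + w.+1) / indicial 1 e) *: 'X^e : {poly K}.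
have sq0 : (size q0 <= e.+1)%N.
  by apply: leq_trans (size_scale_leq _ _) _; rewrite size_polyXn.
have [s1 c1] := Dop_top 1 q0 e sq0.
have [|q [r e1 sr]] := IH (p - Dop 1 q0).
  rewrite en ltnS; apply/leq_sizeP => j; rewrite leq_eqVlt => /predU1P [<-|lt_j].
    by rewrite coefB c1 coefZ coefXn eqxx mulr1 mulrC divfK ?subrr.
  rewrite coefB (nth_default 0 (leq_trans s1 lt_j)) nth_default ?subrr //.
  by apply: leq_trans sp _; rewrite en.
by exists (q0 + q), r; rewrite // DopD -addrA -e1 addrC subrK.
Qed.

(** Cancelling one [a] raises the index of the operator, so the induction on [n] keeps [k]
    general. *)
Lemma Dop_eq_aXnM n k p q : a != 0 ->
  (forall i, (0 < i)%N -> coprimep (i%:R *: a^`() + b) a) ->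
  (size p <= w.+1)%N -> a ^+ n * p = Dop k.+1 q -> p = 0.
Proof.
move=> a0 cop sp.
elim: n k q => [|n IH] k q.
  rewrite mul1r => e; move: (e); rewrite (Dop_small_eq0 k q) -?e //.
  by rewrite /Dop deriv0 !mulr0 addr0.
move=> e.
have : a %| (k.+1%:R *: a^`() + b) * q.
  have -> : (k.+1%:R *: a^`() + b) * q = Dop k.+1 q - a * q^`() by rewrite /Dop; ring.
  by rewrite -e exprS -mulrA -mulrBr dvdp_mulr.
rewrite Gauss_dvdpr; last by rewrite coprimep_sym cop.
case/dvdpP=> q1 q_eq.
apply: (IH k.+1 q1); apply: (mulfI a0); rewrite mulrA -exprS e -DopMa.
by rewrite q_eq mulrC.
Qed.

(** * Nondegeneracy of the functionals *)

Variable fs : 'I_w.+1 -> nat -> K.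
Hypotheses (fs_free : series_free fs) (fs_L : forall j, L_in_poly a b (fs j)).

(* [Dop 1] has cokernel of dimension [w + 1], which the [w + 1] independent
   functionals [phi (fs j)] therefore separate. *)
Lemma phi_fs_eq0_Dop1 p :
  (forall j, phi (fs j) p = 0) -> exists q, p = Dop 1 q.
Proof.
pose B := \matrix_(l < w.+1, j < w.+1) fs j l.
have phi_small r j : (size r <= w.+1)%N -> phi (fs j) r = \sum_(l < w.+1) r`_l * B l j.
  by move=> sr; rewrite (phi_widen _ _ _ _ sr); apply: eq_bigr => l _; rewrite mxE.
(* A combination of the [fs] that vanishes at the indices up to [w] vanishes at every [k], since
   [z^k] is congruent modulo the image of [D_1] to a polynomial of degree at most [w]. *)
have detB : \det B != 0.
  rewrite -det_tr; apply/det0P => -[v v0 vB].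
  case/eqP: v0; apply/rowP => j; rewrite mxE.
  apply: (fs_free (v 0)) => k.
  have [q [r Xk sr]] := Dop1_division 'X^k.
  have fsk i : fs i k = \sum_(l < w.+1) r`_l * B l i.
    by rewrite -phiXn Xk linearD /= (phi_Dop1 _ _ (fs_L i)) add0r phi_small.
  under eq_bigr do rewrite fsk mulr_sumr.
  rewrite exchange_big big1 // => l _ /=.
  transitivity (r`_l * (v *m B^T) 0 l); last by rewrite vB mxE mulr0.
  rewrite mxE mulr_sumr; apply: eq_bigr => i _; rewrite [B^T _ _]mxE.
  by ring.
move=> p0; have [q [r e sr]] := Dop1_division p; exists q.
suff r0 : r = 0 by rewrite e r0 addr0.
have rB : (\row_(l < w.+1) r`_l) *m B = 0.
  apply/rowP => j; rewrite !mxE -[RHS](p0 j) e linearD /= (phi_Dop1 _ _ (fs_L j)).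
  by rewrite add0r phi_small //; apply: eq_bigr => l _; rewrite [X in X * _]mxE.
apply/polyP => l; rewrite coef0; have [lt_lw|le_wl] := ltnP l w.+1; last first.
  by rewrite nth_default // (leq_trans sr).
have [r0|r0] := eqVneq (\row_(l < w.+1) r`_l) 0; last first.
  by case/det0P: detB; exists (\row_(l < w.+1) r`_l).
by have /rowP/(_ (Ordinal lt_lw)) := r0; rewrite !mxE.
Qed.

Lemma det_phi_aXn_neq0 n : a != 0 ->
  (forall i, (0 < i)%N -> coprimep (i%:R *: a^`() + b) a) ->
  \det (\matrix_(j < w.+1, l < w.+1) phi (fs j) (a ^+ n * 'X^l)) != 0.
Proof.
move=> a0 cop; rewrite -det_tr; apply/det0P => -[v v0 vA].
pose p := \poly_(l < w.+1) v 0 (inord l).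
have [|q] := phi_fs_eq0_Dop1 (a ^+ n * p).
  move=> j; have /rowP/(_ j) := vA; rewrite !mxE => vj.
  rewrite -[RHS]vj /p poly_def mulr_sumr linear_sum; apply: eq_bigr => l _ /=.
  by rewrite inord_val -scalerAr linearZ /= !mxE.
move/(Dop_eq_aXnM _ _ _ _ a0 cop (size_poly _ _)) => p0.
case/eqP: v0; apply/rowP => l; rewrite mxE.
have := congr1 (fun r : {poly K} => r`_l) p0.
by rewrite coef_poly ltn_ord inord_val coef0.
Qed.

(** * Evaluation of the determinant *)

Lemma Delta_matrix_const n : a != 0 -> n`!%:R != 0 :> K ->
  (forall i, (0 < i)%N -> coprimep (i%:R *: a^`() + b) a) ->
  exists c : K, c != 0 /\
  \det (\matrix_(i < w.+2, j < w.+2)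
          if unlift ord0 i is Some i' then Qpol a b (fs i') n j
          else Ppol a b n j) = c%:P.
Proof.
move=> a0 nf0 cop; set D := \det _.
(* [r0] is the degree of [P m], and [N] places the coefficient of [z^(-n-1)] in a remainder at index
   [r0 + 1]. *)
pose m := w.+1; pose r0 := (m + n * m)%N; pose N := (r0 + n).+2.
pose P (l : nat) := Ppol a b n l.
have PE l : P l = (n`!%:R)^-1 *: Dchain n 'X^l by exact: PpolE.
have P_top l : (size (P l) <= (l + n * m).+1)%N /\ (P l)`_(l + n * m) != 0.
  have [|s c] := Dchain_top n 'X^l l; first by rewrite size_polyXn.
  rewrite PE size_scale ?invr_neq0 //; split=> //.
  rewrite coefZ c coefXn eqxx mulr1 mulf_neq0 ?invr_neq0 //.
  by apply/prodf_neq0 => i _; exact: indicial_neq0.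
have sP l : (l < m.+1)%N -> (size (P l) <= r0.+1)%N.
  move=> lt_l; have [s _] := P_top l; apply: leq_trans s _.
  by rewrite ltnS leq_add2r.
pose rem j l := remainder K (fs j) N (P l).
have rem_top j l : (l < m.+1)%N ->
    (size (rem j l) <= r0.+2)%N
    /\ (rem j l)`_r0.+1 = (-1) ^+ n * phi (fs j) (a ^+ n * 'X^l).
  move=> lt_l; have s := sP l lt_l.
  have phiP k : phi (fs j) ('X^k * P l)
      = (n`!%:R)^-1 * phi (fs j) ('X^k * Dchain n 'X^l).
    by rewrite PE -scalerAr linearZ.
  have remE k : (k <= n)%N -> (rem j l)`_(N.-1 - k) = phi (fs j) ('X^k * P l).
    move=> le_kn; apply: coef_remainder; last by rewrite /N; lia.
    by apply: leq_trans (leq_add le_kn s) _; rewrite /N; lia.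
  split; last first.
    have -> : r0.+1 = (N.-1 - n)%N by rewrite /N; lia.
    rewrite remE // phiP (phi_Dchain_top _ _ _ (fs_L j)) -mulrA mulrCA.
    by rewrite mulKf.
  (* Indices from [r0 + 2] to [N - 1] vanish by orthogonality; from [N] on, [Q] has cancelled
     everything. *)
  apply/leq_sizeP => i le_i; have [lt_iN|le_Ni] := ltnP i N; last first.
    by apply: coef_remainder_high => //; apply: leq_trans s _; rewrite /N; lia.
  have -> : i = (N.-1 - (N.-1 - i))%N by move: lt_iN; rewrite /N; lia.
  rewrite remE; last by move: le_i; rewrite /N; lia.
  rewrite phiP (phi_Dchain_orth _ _ _ _ (fs_L j)) ?mulr0 //.
  by move: le_i lt_iN; rewrite /N; lia.
pose Pm := \row_(l < m.+1) P l.
pose Qm := \matrix_(j < m, l < m.+1) Qpol a b (fs j) n l.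
pose Rm := \matrix_(j < m, l < m.+1) rem j l.
pose F := \col_(j < m) \poly_(i < N) fs j (N.-1 - i)%N.
have detE : D = \det (col_mx Pm Qm : 'M_(1 + m)).
  congr (\det _); apply/matrixP => i j; rewrite [LHS]mxE.
  case: unliftP => [i' ->|->].
    have -> : lift ord0 i' = rshift 1 i' by apply: val_inj.
    by rewrite (@col_mxEd _ 1) mxE.
  have -> : ord0 = lshift m ord0 :> 'I_(1 + m) by apply: val_inj.
  by rewrite (@col_mxEu _ 1) mxE.
(* Each remainder row is an entry of [F] times the [P] row minus [z^N] times a [Q] row. *)
have detR : (- 'X^N) ^+ m * D = \det (col_mx Pm Rm : 'M_(1 + m)).
  have -> : (col_mx Pm Rm : 'M_(1 + m))
      = block_mx 1%:M 0 F (- 'X^N)%:M *m (col_mx Pm Qm : 'M_(1 + m)).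
    rewrite mul_block_col mul1mx mul0mx addr0 mul_scalar_mx; congr col_mx.
    apply/matrixP => j l; rewrite !mxE big_ord1 !mxE mulNr.
    by rewrite /rem /remainder.
  by rewrite det_mulmx det_lblock det1 mul1r det_scalar detE.
(* These row bounds sum to [N m], the power of [z] just gained, so the top coefficient is the
   constant term of [D] up to sign. *)
pose r (i : 'I_(1 + m)) := if i == ord0 then r0 else r0.+1.
have sum_r : (\sum_i r i = N * m)%N.
  rewrite big_ord_recl /r eqxx /= sum_nat_const card_ord.
  by rewrite /N /r0; lia.
have [|sR cR] := size_det_top K _ (col_mx Pm Rm : 'M_(1 + m)) r.
  move=> i j; rewrite /r; case: (unliftP ord0 i) => [i' ->|->].
    have -> : lift ord0 i' = rshift 1 i' by apply: val_inj.
    rewrite (@col_mxEd _ 1) mxE.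
    by have [] := rem_top i' j (ltn_ord j).
  rewrite eqxx.
  have -> : ord0 = lshift m ord0 :> 'I_(1 + m) by apply: val_inj.
  rewrite (@col_mxEu _ 1) mxE; apply: sP; exact: ltn_ord.
rewrite sum_r in sR cR; move: cR; set C := \matrix_(i, j) _ => cR.
have C0 j : C ord0 j = (P j)`_r0.
  rewrite mxE /r eqxx.
  have -> : ord0 = lshift m ord0 :> 'I_(1 + m) by apply: val_inj.
  by rewrite (@col_mxEu _ 1) mxE.
have CS i j : C (lift ord0 i) j = (-1) ^+ n * phi (fs i) (a ^+ n * 'X^j).
  rewrite mxE /r /=.
  have -> : lift ord0 i = rshift 1 i by apply: val_inj.
  by rewrite (@col_mxEd _ 1) mxE; have [] := rem_top i j (ltn_ord j).
(* In row [0] only the last column reaches degree [r0], so the expansion has a single term. *)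
have detC : \det C != 0.
  rewrite (expand_det_row C ord0) big_ord_recr /= big1 ?add0r; last first.
    move=> j _; rewrite C0 nth_default ?mul0r //.
    have [s _] := P_top j; apply: leq_trans s _.
    by rewrite -addSn leq_add2r /=.
  rewrite C0 mulf_neq0 //; first by have [] := P_top m.
  rewrite /cofactor mulf_neq0 ?signr_eq0 //.
  have -> : row' ord0 (col' ord_max C)
      = (-1) ^+ n *: \matrix_(j < m, l < m) phi (fs j) (a ^+ n * 'X^l).
    apply/matrixP => i j; rewrite mxE mxE CS !mxE.
    by rewrite lift_max.
  rewrite detZ; apply: mulf_neq0; first by rewrite expf_neq0 ?signr_eq0.
  exact: det_phi_aXn_neq0.
have detX : D * 'X^(N * m) = (-1) ^+ m * \det (col_mx Pm Rm : 'M_(1 + m)).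
  by rewrite -detR (exprNn 'X^N) -exprM -mulrA signrMK mulrC.
exists ((-1) ^+ m * \det C); split; first by rewrite mulf_neq0 ?signr_eq0.
apply/polyP => i; rewrite coefC.
have -> : D`_i = (D * 'X^(N * m))`_(i + N * m).
  by rewrite coefMXn ltnNge leq_addl /= addnK.
rewrite detX.
have -> : (-1) ^+ m = ((-1) ^+ m)%:P :> {poly K} by rewrite rmorph_sign.
rewrite coefCM; case: eqP => [->|/eqP i0]; first by rewrite add0n cR.
rewrite nth_default ?mulr0 //; apply: leq_trans sR _.
by rewrite -add1n leq_add2r lt0n.
Qed.

End Degree.
End Operator.

(** * Indicial factors from the degree hypotheses *)

Theorem theorem3p1 (K : fieldType) (a b : {poly K})
  (fs : 'I_(wdeg a b).+1 -> nat -> K) :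
  [pchar K] =i pred0 ->
  a != 0 -> b != 0 ->
  (1 < (size a).-1)%N || (0 < (size b).-1)%N ->
  ((size a).-1 = (size b).-1.+1 ->
     forall k : nat, lead_coef a * (k + (size a).-1)%:R + lead_coef b != 0) ->
  series_free fs ->
  (forall j, L_in_poly a b (fs j)) ->
  (forall n : nat, (0 < n)%N -> coprimep (n%:R *: a^`() + b) a) ->
  ((size a).-1 = (size b).-1.+1 ->
     forall k n : nat,
       lead_coef a * ((k.+1 * (size a).-1 + n)%N)%:R + lead_coef b != 0) ->
  forall n : nat, exists c : K, c != 0 /\ Delta fs n = c%:P.
Proof.
move=> char0 a0 b0 w_ge0 _ fs_free fs_L cop lc_neq0 n.
have natr_neq0 k : k.+1%:R != 0 :> K by rewrite ((pcharf0P K).1 char0).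
have sa0 : (0 < size a)%N by rewrite size_poly_gt0.
have sb0 : (0 < size b)%N by rewrite size_poly_gt0.
have sa : (size a <= (wdeg a b).+3)%N by rewrite /wdeg; lia.
have sb : (size b <= (wdeg a b).+2)%N by rewrite /wdeg; lia.
apply: (Delta_matrix_const _ _ _ _ sa sb _ _ fs_free fs_L) => //; last first.
  by rewrite -(prednK (fact_gt0 n)).
move=> k e; rewrite /indicial.
(* Since [w] is a maximum, [a] or [b] attains its degree bound. If only one does, the factor is the
   leading coefficient of [b] or a positive integer multiple of that of [a]; if both do, [u - 1 = v]
   and assumption (b) applies. *)
have [sa_eq|sa_ne] := eqVneq (size a) (wdeg a b).+3; last first.
  have sb_eq : (wdeg a b).+1 = (size b).-1 by move: sa_ne; rewrite /wdeg; lia.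
  have sa' : (size a <= (wdeg a b).+2)%N by lia.
  by rewrite (nth_default 0 sa') mul0r add0r sb_eq -lead_coefE lead_coef_eq0.
have u_eq : (wdeg a b).+2 = (size a).-1 by rewrite sa_eq.
rewrite u_eq -lead_coefE.
have [sb_eq|sb_ne] := eqVneq (size b) (wdeg a b).+2.
  have v_eq : (wdeg a b).+1 = (size b).-1 by rewrite sb_eq.
  by rewrite v_eq -lead_coefE lc_neq0 // sa_eq sb_eq.
have sb' : (size b <= (wdeg a b).+1)%N by lia.
rewrite (nth_default 0 sb') addr0 mulf_neq0 ?lead_coef_eq0 // -u_eq mulSn addSn addSn.
exact: natr_neq0.
Qed.
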